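(* Let $\mathcal{H}$ and $\mathcal{G}$ be real Hilbert spaces, let $L\in\mathcal{B}(\mathcal{H},\mathcal{G})$ satisfy $0<\|L\|\leq 1$, and let $B\in\mathcal{S}(\mathcal{G})$. Then the following hold, where convergence is in the operator norm of $\mathcal{B}(\mathcal{H})$: (i) $L\overset{\gamma}{\bullet}B\to L^*\circ B\circ L$ as $0<\gamma\to 0$. (ii) Suppose that $L$ is bounded below. Then $L\overset{\gamma}{\diamond}B\to L^*\triangleright B$ as $\gamma\to+\infty$.
   Context: $\mathcal{B}(\mathcal{H},\mathcal{G})$ is the space of bounded linear operators from $\mathcal{H}$ to $\mathcal{G}$ with the operator norm, $\mathcal{B}(\mathcal{H})=\mathcal{B}(\mathcal{H},\mathcal{H})$, and $L^*$ is the adjoint of $L$. $\mathcal{P}(\mathcal{H})$ is the set of self-adjoint $A\in\mathcal{B}(\mathcal{H})$ with $\langle Ax,x\rangle\geq 0$ for all $x\in\mathcal{H}$. For self-adjoint $A,B$, $A\preccurlyeq B$ means $B-A\in\mathcal{P}(\mathcal{H})$. $\mathcal{S}(\mathcal{H})$ is the set of $A\in\mathcal{P}(\mathcal{H})$ for which there exists $\alpha>0$ with $\alpha\,\mathrm{Id}_{\mathcal{H}}\preccurlyeq A$. $L$ is bounded below if there exists $\alpha>0$ such that $\alpha\|x\|\leq\|Lx\|$ for all $x\in\mathcal{H}$. For a set-valued operator $M\colon\mathcal{G}\to 2^{\mathcal{G}}$, $M^{-1}$ is the set-valued inverse ($x\in M^{-1}y\Leftrightarrow y\in Mx$); sums and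 compositions are taken in the set-valued sense, e.g. $(L^*\circ M\circ L)x=\{L^*y : y\in M(Lx)\}$; a set-valued operator all of whose values are singletons is identified with the corresponding single-valued operator. The parallel composition of $M$ by $L^*$ is $L^*\triangleright M=(L^*\circ M^{-1}\circ L)^{-1}$. For $\gamma\in\,]0,+\infty[$, the resolvent composition is $$L\overset{\gamma}{\diamond}M=L^*\triangleright(M+\gamma^{-1}\mathrm{Id}_{\mathcal{G}})-\gamma^{-1}\mathrm{Id}_{\mathcal{H}},$$ and the resolvent cocomposition is $$L\overset{\gamma}{\bullet}M=\bigl(L\overset{1/\gamma}{\diamond}M^{-1}\bigr)^{-1}.$$ *)

(* Defs.v *)
From HB Require Import structures.
From mathcomp Require Import all_boot all_order all_algebra.
From mathcomp Require Import boolp classical_sets reals topology normedtype.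

Set Implicit Arguments.
Unset Strict Implicit.
Unset Printing Implicit Defensive.

Import Order.TTheory GRing.Theory Num.Theory.
Import numFieldNormedType.Exports.

Local Open Scope classical_set_scope.
Local Open Scope ring_scope.

(* {dot H for idfun} is the type of symmetric positive definite bilinear
   forms on H; the norm of H is the one induced by the inner product. *)
HB.mixin Record CompleteNormedModule_isHilbert (R : realType) H
    & CompleteNormedModule R H := {
  inner : {dot H for idfun} ;
  sqr_norm_inner : forall x : H, `|x| ^+ 2 = inner x x
}.

#[short(type="hilbertType")]
HB.structure Definition Hilbert (R : realType) :=
  {H of CompleteNormedModule R H & CompleteNormedModule_isHilbert R H}.

Notation "''[' x , y ]" := (inner x y) : ring_scope.

(* For linear maps, continuity is the same as boundedness, see
   linear_bounded_continuous. *)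
HB.structure Definition BoundedLinear (R : realType) (V W : normedModType R) :=
  {f of @GRing.Linear R V W *:%R f & @isContinuous V W f}.

Notation "{ 'bounded' V -> W }" := (BoundedLinear.type V W)
  (at level 0, V at level 98, W at level 99,
   format "{ 'bounded'  V  ->  W }") : type_scope.

Section BoundedLinearInstances.
Variables (R : realType) (V W : normedModType R).

Lemma bounded_sub_continuous (f g : {bounded V -> W}) : continuous (f \- g).
Proof. by move=> x; apply: cvgB; exact: cts_fun. Qed.

HB.instance Definition _ (f g : {bounded V -> W}) :=
  isContinuous.Build V W (f \- g) (@bounded_sub_continuous f g).

Lemma bounded_scale_continuous (a : R) (f : {bounded V -> W}) :
  continuous (a \*: f).
Proof. by move=> x; apply: cvgZl_tmp; exact: cts_fun. Qed.

HB.instance Definition _ (a : R) (f : {bounded V -> W}) :=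
  isContinuous.Build V W (a \*: f) (@bounded_scale_continuous a f).

End BoundedLinearInstances.

HB.instance Definition _ (R : realType) (V : normedModType R) :=
  Continuous.on (@idfun V).

Definition opnorm (R : realType) (V W : normedModType R)
    (f : {bounded V -> W}) : R :=
  sup [set `|f x| | x in [set x : V | `|x| <= 1]].

Section HilbertOperators.
Variables (R : realType) (H G : hilbertType R).

(* The point z below exists by the Riesz representation theorem, and is
   unique; the default value 0 of xget is never used. *)
Definition adjoint (L : {bounded H -> G}) : G -> H :=
  fun y => xget 0 [set z : H | forall x, '[L x, y] = '[x, z]].

Definition bounded_below (L : {bounded H -> G}) : Prop :=
  exists2 a : R, 0 < a & forall x, a * `|x| <= `|L x|.

End HilbertOperators.

Section Positivity.
Variables (R : realType) (H : hilbertType R).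
Implicit Types A B : {bounded H -> H}.

Definition self_adjoint A : Prop := adjoint A = A :> (H -> H).

Definition positive_op A : Prop :=
  self_adjoint A /\ forall x, 0 <= '[A x, x].

Definition loewner_le A B : Prop := positive_op (B \- A).

Definition strongly_positive_op A : Prop :=
  positive_op A /\ exists2 a : R, 0 < a & loewner_le (a \*: idfun) A.

End Positivity.

Definition setop (X Y : Type) := X -> set Y.

Section SetOperators.
Variables (X Y Z : Type).

Definition setop_of (f : X -> Y) : setop X Y := fun x => [set f x].

Definition setop_inv (M : setop X Y) : setop Y X := fun y => [set x | M x y].

Definition setop_comp (N : setop Y Z) (M : setop X Y) : setop X Z :=
  fun x => \bigcup_(y in M x) N y.

End SetOperators.

Section SetOperatorsArith.
Variables (X : Type) (V : zmodType).
Implicit Types M N : setop X V.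

Definition setop_add M N : setop X V :=
  fun x => [set y + z | y in M x & z in N x].

Definition setop_sub M N : setop X V :=
  fun x => [set y - z | y in M x & z in N x].

End SetOperatorsArith.

Section ResolventCompositions.
Variables (R : realType) (H G : hilbertType R).
Implicit Types (L : {bounded H -> G}) (M : setop G G) (gamma : R).

Definition parallel_comp L M : setop H H :=
  setop_inv (setop_comp (setop_of (adjoint L))
                        (setop_comp (setop_inv M) (setop_of L))).

Definition resolvent_comp gamma L M : setop H H :=
  setop_sub
    (parallel_comp L (setop_add M (setop_of (fun y : G => gamma^-1 *: y))))
    (setop_of (fun x : H => gamma^-1 *: x)).

Definition resolvent_cocomp gamma L M : setop H H :=
  setop_inv (resolvent_comp gamma^-1 L (setop_inv M)).

End ResolventCompositions.

(* Convergence in operator norm of a family of set-valued operators indexed by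
   ]0, +oo[: every member of the family and the limit are single-valued, and
   are identified with elements of B(H). *)
Definition setop_cvg (R : realType) (H : hilbertType R) (F : set_system R)
    (M_ : R -> setop H H) (M : setop H H) : Prop :=
  exists (T_ : R -> {bounded H -> H}) (T : {bounded H -> H}),
    [/\ forall gamma, 0 < gamma -> M_ gamma = setop_of (T_ gamma),
        M = setop_of T
      & opnorm (T_ gamma \- T) @[gamma --> F] --> (0 : R)].

(* Main.v *)
(* Both limits come from the shape of the equations behind the two operators.
   The relation [y \in cocomp gamma x] means [y = L^* B z] with
   [z + gamma (Id - L L^* ) B z = L x]; pairing [z - L x] with [B (z - L x)]
   and using [L L^* <= Id] gives [`|z - L x| = O(gamma `|x|)].
   The relation [y \in comp gamma x] means [y = p - x / gamma] with
   [L^* z = x] and [(B + Id / gamma) z = L p]; subtracting the system of the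
   limit [L^* z0 = x], [B z0 = L p0], the difference [z - z0] lies in [ker L^*],
   so pairing with it removes [p - p0] and gives [`|z - z0| = O(`|x| / gamma)].
   Existence, including that of the adjoint, reduces to representing a
   functional by a symmetric coercive bilinear form. *)
Require Import Defs.
From HB Require Import structures.
From mathcomp Require Import all_boot all_order all_algebra.
From mathcomp Require Import boolp classical_sets reals topology normedtype.
From mathcomp Require Import sequences.
From mathcomp Require Import ring lra.

Set Implicit Arguments.
Unset Strict Implicit.
Unset Printing Implicit Defensive.

Import Order.TTheory GRing.Theory Num.Theory.
Import numFieldNormedType.Exports.

Local Open Scope classical_set_scope.
Local Open Scope ring_scope.

(** * Inner product calculus and the Cauchy-Schwarz inequality *)

Section InnerProduct.
Variables (R : realType) (H : hilbertType R).
Implicit Types (x y z : H) (k : R).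

Lemma innerC x y : '[x, y] = '[y, x].
Proof. by rewrite [LHS]hermC expr0 mul1r. Qed.

Lemma innerPr z k x y : '[z, k *: x + y] = k * '[z, x] + '[z, y].
Proof. by rewrite linearPr. Qed.

Lemma innerDr z x y : '[z, x + y] = '[z, x] + '[z, y].
Proof. by rewrite linearDr. Qed.

Lemma innerZr z k x : '[z, k *: x] = k * '[z, x].
Proof. by rewrite linearZr. Qed.

Lemma innerBr z x y : '[z, x - y] = '[z, x] - '[z, y].
Proof. by rewrite linearBr. Qed.

Lemma innerDl z x y : '[x + y, z] = '[x, z] + '[y, z].
Proof. by rewrite linearDl. Qed.

Lemma innerZl z k x : '[k *: x, z] = k * '[x, z].
Proof. by rewrite innerC innerZr innerC. Qed.

Lemma innerBl z x y : '[x - y, z] = '[x, z] - '[y, z].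
Proof. by rewrite linearBl. Qed.

Lemma inner_eq0 x : (forall y, '[x, y] = 0) -> x = 0.
Proof.
by move=> x0; apply/eqP; rewrite -normr_eq0 -sqrf_eq0 sqr_norm_inner x0.
Qed.

Lemma inner_inj x y : (forall z, '[z, x] = '[z, y]) -> x = y.
Proof.
move=> xy; apply/eqP; rewrite -subr_eq0; apply/eqP/inner_eq0 => z.
by rewrite innerC innerBr xy subrr.
Qed.

Lemma CauchySchwarz_inner x y : `|'[x, y]| <= `|x| * `|y|.
Proof.
have [->|y0] := eqVneq y 0.
  by rewrite linear0r normr0 mulr_ge0.
have y_gt0 : 0 < `|y| by rewrite normr_gt0.
(* The vector is [|y|^2] times the component of [x] orthogonal to [y]; its squared norm is
   [|y|^2 (|x|^2 |y|^2 - <x, y>^2)]. *)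
have : 0 <= `| (`|y| ^+ 2) *: x - '[x, y] *: y| ^+ 2 by rewrite sqr_ge0.
rewrite sqr_norm_inner !(innerBl, innerBr, innerZl, innerZr) (innerC y x).
rewrite -!sqr_norm_inner => h.
rewrite -(@ler_pXn2r _ 2) ?nnegrE ?mulr_ge0// real_normK ?num_real//.
rewrite exprMn -subr_ge0 -(@pmulr_rge0 _ (`|y| ^+ 2)) ?exprn_gt0//.
by apply: le_trans h _; rewrite le_eqVlt; apply/orP; left; apply/eqP; ring.
Qed.

End InnerProduct.

(** * Operator norm, and linear relations that are bounded operators *)

Section BoundedOperators.
Variables (R : realType) (V W : normedModType R).
Implicit Types f : {bounded V -> W}.

Lemma bounded_bound f : exists2 K : R, 0 < K & forall x, `|f x| <= K * `|x|.
Proof.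
have /linear_bounded_continuous/linear_boundedP[M [_ fM]] :
  continuous (f : {linear V -> W}) by move=> x; exact: cts_fun.
(* Every constant strictly above [M] bounds [f]; the maximum with [0] and the added [1] make the
   chosen one positive as well. *)
exists (Num.max 0 M + 1);
  last by apply: fM; rewrite ltr_pwDr// le_max lexx orbT.
by rewrite ltr_pwDr// le_max lexx.
Qed.

Lemma has_ubound_opnorm f :
  has_ubound [set `|f x| | x in [set x : V | `|x| <= 1]].
Proof.
have [K K0 fK] := bounded_bound f.
exists K => _ [y /= y1 <-]; apply: le_trans (fK y) _.
by rewrite ler_piMr// ltW.
Qed.

Lemma le_opnorm f x : `|f x| <= opnorm f * `|x|.
Proof.
have [->|x0] := eqVneq x 0; first by rewrite linear0 !normr0 mulr0.
have x_gt0 : 0 < `|x| by rewrite normr_gt0.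
rewrite -ler_pdivrMr//.
have -> : `|f x| / `|x| = `|f (`|x|^-1 *: x)|.
  by rewrite linearZ/= normrZ ger0_norm ?invr_ge0// mulrC.
apply: ub_le_sup; first exact: has_ubound_opnorm.
exists (`|x|^-1 *: x) => //=.
by rewrite normrZ ger0_norm ?invr_ge0// mulVf// gt_eqF.
Qed.

Lemma opnorm_ge0 f : 0 <= opnorm f.
Proof.
apply: ub_le_sup; first exact: has_ubound_opnorm.
by exists 0 => /=; rewrite ?normr0// linear0 normr0.
Qed.

Lemma opnorm_le f (K : R) : 0 <= K -> (forall x, `|f x| <= K * `|x|) ->
  opnorm f <= K.
Proof.
move=> K0 fK; apply: ge_sup.
  by exists `|f 0|; exists 0 => //=; rewrite normr0.
by move=> _ [y /= y1 <-]; apply: le_trans (fK y) _; rewrite ler_piMr.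
Qed.

(** Linearity is stated on graphs, so that it passes through inverses, compositions and sums before
    single-valuedness is known. *)
Definition setop_linear (M : setop V W) : Prop :=
  forall (k : R) x x' y y',
    M x y -> M x' y' -> M (k *: x + x') (k *: y + y').

(** Two values at the same [x] differ by a value at [0], which the bound forces to vanish. A total
    bounded linear relation is therefore the graph of an operator. *)
Lemma setop_linear_bounded (M : setop V W) (K : R) :
    setop_linear M -> (forall x, exists y, M x y) ->
    (forall x y, M x y -> `|y| <= K * `|x|) ->
  exists f : {bounded V -> W}, M = setop_of f.
Proof.
move=> Mlin Mtot MK.
have Minj x y y' : M x y -> M x y' -> y = y'.
  move=> My My'; apply/eqP; rewrite -subr_eq0 -normr_le0.
  have := MK _ _ (Mlin (-1) _ _ _ _ My' My).
  by rewrite !scaleN1r addNr normr0 mulr0 addrC.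
have [f Mf] := choice Mtot.
have flin : linear f.
  by move=> k x x'; exact: (Minj (k *: x + x')) (Mlin _ _ _ _ _ _ _).
pose fL := GRing.isLinear.Build R V W *:%R f flin.
pose f1 : {linear V -> W} := HB.pack f fL.
have fcts : continuous f1.
  apply/linear_bounded_continuous/linear_boundedP.
  exists K; split; first exact: num_real.
  move=> r Kr x; apply: le_trans (MK _ _ (Mf x)) _.
  by rewrite ler_wpM2r// ltW.
pose f2 : {bounded V -> W} := HB.pack f fL (isContinuous.Build V W f fcts).
exists f2; apply/funext => x; apply/seteqP; split => [y My|_ ->].
  exact: Minj My (Mf x).
exact: Mf.
Qed.

End BoundedOperators.

(** * Minimisation of the energy of a symmetric coercive form *)

Section CoerciveForm.
Variables (R : realType) (V : completeNormedModType R).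
Variables (a : V -> V -> R) (f : V -> R) (c C K : R).
Hypothesis a_linear : forall z k x y, a z (k *: x + y) = k * a z x + a z y.
Hypothesis a_sym : forall x y, a x y = a y x.
Hypothesis c_gt0 : 0 < c.
Hypothesis a_coercive : forall x, c * `|x| ^+ 2 <= a x x.
Hypothesis a_bounded : forall x y, `|a x y| <= C * `|x| * `|y|.
Hypothesis f_linear : forall k x y, f (k *: x + y) = k * f x + f y.
Hypothesis f_bounded : forall x, `|f x| <= K * `|x|.

Let q x := a x x - 2 * f x.

Let q_line x t y :
  q (t *: y + x) = q x + t ^+ 2 * a y y + 2 * t * (a x y - f y).
Proof.
rewrite /q a_linear f_linear (a_sym _ x) a_linear (a_sym _ y) a_linear.
rewrite (a_sym y x).
ring.
Qed.

(** Coercivity and the bound on [f] leave [c n^2 - 2 K n] with [n = |x|], where the square is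
    completed. *)
Let q_lower x : - (K ^+ 2 / c) <= q x.
Proof.
have := a_coercive x; have /ler_normlP[_] := f_bounded x.
rewrite /q; move: `|x| (a x x) (f x) => n b d h1 h2.
have : 0 <= (c * n - K) ^+ 2 / c by rewrite divr_ge0 ?sqr_ge0// ltW.
have -> : (c * n - K) ^+ 2 / c = c * n ^+ 2 - 2 * (K * n) + K ^+ 2 / c.
  by field; rewrite gt_eqF.
lra.
Qed.

(** Parallelogram identity of the energy: the linear part cancels against the midpoint, so two
    points of nearly minimal energy are close to each other. *)
Let q_midpoint x y :
  a (x - y) (x - y) = 2 * q x + 2 * q y - 4 * q (2^-1 *: (x - y) + y).
Proof.
rewrite q_line.
have -> : q x = q (1 *: (x - y) + y) by rewrite scale1r subrK.
by rewrite q_line; field.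
Qed.

(* [f] is represented by the minimiser of the energy [a x x - 2 * f x]. *)
Lemma coercive_representation : exists z, forall y, a z y = f y.
Proof.
pose m := inf (range q).
have q_inf : has_inf (range q).
  split; first by exists (q 0), 0.
  by exists (- (K ^+ 2 / c)) => _ [x _ <-]; exact: q_lower.
have m_le x : m <= q x by apply: ge_inf; [case: q_inf|exists x].
have /choice[x_ x_min] n : exists x, q x < m + n.+1%:R^-1.
  have [|_ [x _ <-] xm] := @inf_adherent _ (range q) n.+1%:R^-1 _ q_inf.
    by rewrite invr_gt0.
  by exists x.
have x_dist n k :
    c * `|x_ n - x_ k| ^+ 2 <= 2 * n.+1%:R^-1 + 2 * k.+1%:R^-1.
  apply: le_trans (a_coercive _) _; rewrite q_midpoint.
  have := m_le (2^-1 *: (x_ n - x_ k) + x_ k).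
  move: (x_min n) (x_min k) (q _) => + + qm.
  move: (q (x_ n)) (q (x_ k)) n.+1%:R^-1 k.+1%:R^-1 => qn qk en ek.
  lra.
have inv_cvg0 := @cvg_harmonic R.
have /cvg_ex[z x_cvg] : cvg (x_ @ \oo).
  apply/cauchy_cvgP/cauchy_exP => e e0.
  (* With this tolerance [x_dist] gives [c |x_n - x_N|^2 < 4 (c e^2 / 4) = c e^2]. *)
  have e1 : 0 < c * e ^+ 2 / 4 by rewrite divr_gt0// mulr_gt0// exprn_gt0.
  have /cvgrPdist_lt/(_ _ e1)[N _ hN] := inv_cvg0.
  exists (x_ N), N => // n /= Nn; rewrite -ball_normE /ball_/=.
  have := hN N (leqnn N); have := hN n Nn; rewrite /= !sub0r !normrN /harmonic.
  rewrite !ger0_norm ?invr_ge0// => hn' hN'.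
  rewrite -(@ltr_pXn2r _ 2) ?nnegrE ?(ltW e0)// -(ltr_pM2l c_gt0).
  apply: le_lt_trans (x_dist _ _) _; move: hn' hN'.
  by move: n.+1%:R^-1 N.+1%:R^-1 => en eN; lra.
exists z => y.
(* The added [1] keeps the division by [A] legitimate when [y = 0]. *)
pose A := a y y + 1.
have A0 : 0 < A.
  rewrite ltr_wpDl//; apply: le_trans (a_coercive y).
  by rewrite mulr_ge0 ?sqr_ge0// ltW.
have res n : (a (x_ n) y - f y) ^+ 2 <= A * n.+1%:R^-1.
  (* With [b] the residual [a (x_ n) y - f y], the step [- b / A] along [y] would lower the energy
     by at least [b^2 / A]; near-minimality of [x_ n] bounds this gain. *)
  have := m_le (- ((a (x_ n) y - f y) / A) *: y + x_ n).
  rewrite q_line; move: (x_min n) (a (x_ n) y - f y) => + b.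
  move: (q (x_ n)) n.+1%:R^-1 => qx e h1 h2.
  have h3 : b ^+ 2 / A <= e.
    have -> : b ^+ 2 / A = - ((b / A) ^+ 2 * A + 2 * (- (b / A)) * b).
      by field; rewrite gt_eqF.
    have : (b / A) ^+ 2 * a y y <= (b / A) ^+ 2 * A.
      by rewrite ler_wpM2l ?sqr_ge0// lerDl.
    move: h2; rewrite sqrrN; lra.
  by rewrite mulrC -ler_pdivrMr.
have a_cvg : a (x_ n) y @[n --> \oo] --> a z y.
  apply/cvgrPdist_le => e e0.
  have D0 : 0 < `|C| * `|y| + 1 by rewrite ltr_wpDl// mulr_ge0.
  have /cvgrPdist_le/(_ (e / (`|C| * `|y| + 1))) := x_cvg.
  rewrite divr_gt0// => /(_ isT); apply: filterS => n hn.
  have -> : a z y - a (x_ n) y = a (z - x_ n) y.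
    have := a_linear y (-1) (x_ n) z.
    by rewrite scaleN1r mulN1r addrC [RHS]addrC a_sym (a_sym y) (a_sym y) => ->.
  apply: le_trans (a_bounded _ _) _.
  have : C * `|z - x_ n| * `|y| <= (`|C| * `|y| + 1) * `|z - x_ n|.
    rewrite mulrDl mul1r mulrAC ler_wpDr// ler_wpM2r// ler_wpM2r//.
    exact: ler_norm.
  move/le_trans; apply; rewrite mulrC -ler_pdivlMr//.
have sq_cvg : (a (x_ n) y - f y) ^+ 2 @[n --> \oo] --> (a z y - f y) ^+ 2.
  exact: cvgM (cvgB a_cvg (cvg_cst _)) (cvgB a_cvg (cvg_cst _)).
have A_cvg : A * n.+1%:R^-1 @[n --> \oo] --> A * 0.
  exact: cvgMl_tmp inv_cvg0.
have : (a z y - f y) ^+ 2 <= A * 0.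
  by apply: ler_cvg_to sq_cvg A_cvg _; exact: nearW.
rewrite mulr0 => h; apply/eqP; rewrite -subr_eq0 -sqrf_eq0.
by rewrite eq_le h sqr_ge0.
Qed.

End CoerciveForm.

(** * Riesz representation and the adjoint *)

Lemma riesz_representation (R : realType) (H : hilbertType R) (f : H -> R)
    (K : R) :
    (forall k x y, f (k *: x + y) = k * f x + f y) ->
    (forall x, `|f x| <= K * `|x|) ->
  exists z, forall x, f x = '[x, z].
Proof.
move=> f_linear f_bounded.
have [||||z fz] := @coercive_representation R H (fun x y => '[x, y]) f 1 1 K
    _ _ ltr01 _ _ f_linear f_bounded.
- by move=> z k x y; exact: innerPr.
- exact: innerC.
- by move=> x; rewrite mul1r sqr_norm_inner.
- by move=> x y; rewrite mul1r CauchySchwarz_inner.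
- by exists z => x; rewrite innerC.
Qed.

Section Adjoint.
Variables (R : realType) (H G : hilbertType R) (L : {bounded H -> G}).

(** Riesz representation of the functional [<L x, y>] of [x] shows that the set defining [adjoint]
    is inhabited, so [xget] picks one of its points. *)
Lemma adjointE x y : '[L x, y] = '[x, adjoint L y].
Proof.
have := @xgetPex _ 0 [set z : H | forall x, '[L x, y] = '[x, z]].
apply.
apply: (@riesz_representation _ _ (fun x => '[L x, y]) (opnorm L * `|y|)).
  by move=> k u v; rewrite linearP innerDl innerZl.
move=> u; apply: le_trans (CauchySchwarz_inner _ _) _.
by rewrite mulrAC ler_wpM2r// le_opnorm.
Qed.

Lemma adjoint_is_linear : linear (adjoint L).
Proof.
move=> k x y; apply: inner_inj => z.
by rewrite innerPr -!adjointE innerPr.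
Qed.

HB.instance Definition _ :=
  GRing.isLinear.Build R G H *:%R (adjoint L) adjoint_is_linear.

Lemma norm_adjoint y : `|adjoint L y| <= opnorm L * `|y|.
Proof.
have [->|y0] := eqVneq (adjoint L y) 0.
  by rewrite normr0 mulr_ge0// opnorm_ge0.
rewrite -(@ler_pM2r _ `|adjoint L y|) ?normr_gt0// -expr2 sqr_norm_inner.
rewrite -adjointE.
apply: le_trans (ler_norm _) (le_trans (CauchySchwarz_inner _ _) _).
by rewrite mulrAC ler_wpM2r// le_opnorm.
Qed.

End Adjoint.

(** * Invertibility of symmetric coercive operators *)

Section SymmetricCoercive.
Variables (R : realType) (G : hilbertType R) (D : {bounded G -> G}) (c : R).
Hypothesis D_sym : forall x y, '[D x, y] = '[x, D y].
Hypothesis c_gt0 : 0 < c.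
Hypothesis D_coercive : forall x, c * `|x| ^+ 2 <= '[D x, x].

(** One factor [n] cancels, the case [n = 0] being treated apart. This turns an energy estimate into
    a norm estimate. *)
Lemma ler_coercive (k n : R) : 0 <= n -> 0 <= k ->
  c * n ^+ 2 <= k * n -> n <= k / c.
Proof.
rewrite le_eqVlt => /predU1P[<- k0 _|n0 k0]; first by rewrite divr_ge0// ltW.
by rewrite expr2 mulrA ler_pM2r// mulrC -ler_pdivlMr.
Qed.

Lemma coercive_norm_le x : `|x| <= c^-1 * `|D x|.
Proof.
rewrite mulrC; apply: ler_coercive => //; apply: le_trans (D_coercive x) _.
exact: le_trans (ler_norm _) (CauchySchwarz_inner _ _).
Qed.

Lemma coercive_surjective y : exists x, D x = y.
Proof.
have [|||||z Dz] := @coercive_representation R G (fun x w => '[D x, w])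
    (fun w => '[y, w]) c (opnorm D) `|y| _ _ c_gt0 D_coercive.
- by move=> z k u v; exact: innerPr.
- by move=> u v; rewrite D_sym innerC.
- move=> u v; apply: le_trans (CauchySchwarz_inner _ _) _.
  by rewrite ler_wpM2r// le_opnorm.
- by move=> k u v; exact: innerPr.
- by move=> u; exact: CauchySchwarz_inner.
- by exists z; apply: inner_inj => u; rewrite innerC Dz innerC.
Qed.

(** The inverse relation of [D] is linear, total by surjectivity and bounded by [c^-1], hence a
    bounded operator. *)
Lemma coercive_inverse : exists (E : {bounded G -> G}) (c' : R),
  [/\ 0 < c', forall x, D (E x) = x, forall x y, '[E x, y] = '[x, E y]
    & forall x, c' * `|x| ^+ 2 <= '[E x, x]].
Proof.
have [|y|x y ->|E DE] := @setop_linear_bounded _ _ _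
    (setop_inv (setop_of D)) c^-1.
- by move=> k x x' y y' -> ->; rewrite /setop_inv/setop_of/= linearP.
- by have [x <-] := coercive_surjective y; exists x.
- exact: coercive_norm_le.
have {}DE x : D (E x) = x.
  by have : setop_of E x (E x) by []; rewrite -DE.
have [K K0 DK] := bounded_bound D.
(* The constant comes from [|x| = |D (E x)| <= K |E x|] and the coercivity of [D] at [E x]. *)
exists E, (c / K ^+ 2); split => //.
- by rewrite divr_gt0// exprn_gt0.
- by move=> x y; rewrite -{1}(DE y) -D_sym DE.
- move=> x; have -> : '[E x, x] = '[D (E x), E x] by rewrite DE innerC.
  apply: le_trans (D_coercive _).
  rewrite -mulrA ler_pM2l// mulrC ler_pdivrMr ?exprn_gt0// -exprMn.
  by rewrite lerXn2r ?nnegrE ?mulr_ge0// ?(ltW K0)// mulrC -{1}(DE x) DK.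
Qed.

End SymmetricCoercive.

(** * Stability of linear relations under the set-valued operations *)

Section SetopLinear.
Variables (R : realType) (U V W : normedModType R).

Lemma setop_linear_of (f : V -> W) : linear f -> setop_linear (setop_of f).
Proof. by move=> flin k x x' y y' -> ->; rewrite /setop_of/= flin. Qed.

Lemma setop_linear_inv (M : setop V W) :
  setop_linear M -> setop_linear (setop_inv M).
Proof. by move=> Mlin k x x' y y'; exact: Mlin. Qed.

Lemma setop_linear_comp (M : setop U V) (N : setop V W) :
  setop_linear M -> setop_linear N -> setop_linear (setop_comp N M).
Proof.
move=> Mlin Nlin k x x' y y' [u xu uy] [u' xu' uy'].
by exists (k *: u + u'); [exact: Mlin|exact: Nlin].
Qed.

Lemma setop_linear_add (M N : setop V W) :
  setop_linear M -> setop_linear N -> setop_linear (setop_add M N).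
Proof.
move=> Mlin Nlin k x x' _ _ [u xu [v xv <-]] [u' xu' [v' xv' <-]].
exists (k *: u + u'); first exact: Mlin.
exists (k *: v + v'); first exact: Nlin.
by rewrite scalerDr addrACA.
Qed.

Lemma setop_linear_sub (M N : setop V W) :
  setop_linear M -> setop_linear N -> setop_linear (setop_sub M N).
Proof.
move=> Mlin Nlin k x x' _ _ [u xu [v xv <-]] [u' xu' [v' xv' <-]].
exists (k *: u + u'); first exact: Mlin.
exists (k *: v + v'); first exact: Nlin.
by rewrite scalerBr opprD addrACA.
Qed.

End SetopLinear.

(** * The resolvent compositions as systems of equations *)

Section ResolventCompositionsE.
Variables (R : realType) (H G : hilbertType R) (L : {bounded H -> G}).
Variable (B : {bounded G -> G}).
Implicit Types (M : setop G G) (gamma : R) (x y : H).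

Lemma setop_linear_parallel_comp M :
  setop_linear M -> setop_linear (parallel_comp L M).
Proof.
move=> Mlin; apply: setop_linear_inv; apply: setop_linear_comp; last first.
  by apply: setop_linear_of; exact: linearP.
apply: setop_linear_comp; last exact: setop_linear_inv.
by apply: setop_linear_of; exact: linearP.
Qed.

Lemma setop_linear_resolvent_comp gamma M :
  setop_linear M -> setop_linear (resolvent_comp gamma L M).
Proof.
move=> Mlin; apply: setop_linear_sub; last first.
  by apply: setop_linear_of; exact: linearP.
apply: setop_linear_parallel_comp; apply: setop_linear_add => //.
by apply: setop_linear_of; exact: linearP.
Qed.

Lemma setop_linear_resolvent_cocomp gamma M :
  setop_linear M -> setop_linear (resolvent_cocomp gamma L M).
Proof.
move=> Mlin; apply: setop_linear_inv; apply: setop_linear_resolvent_comp.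
exact: setop_linear_inv.
Qed.

Lemma parallel_compP M x y :
  parallel_comp L M x y <-> exists2 z, adjoint L z = x & M z (L y).
Proof.
split=> [[z [_ -> Mz] ->]|[z <- Mz]]; first by exists z.
by exists z => //; exists (L y).
Qed.

Lemma resolvent_compP gamma x y :
  resolvent_comp gamma L (setop_of B) x y <->
  exists z p, [/\ adjoint L z = x, B z + gamma^-1 *: z = L p &
    y = p - gamma^-1 *: x].
Proof.
split=> [[p /parallel_compP[z zx [_ -> [_ -> BzE]]] [_ -> <-]]|].
  by exists z, p.
move=> [z [p [zx zp ->]]]; exists p; last by exists (gamma^-1 *: x).
apply/parallel_compP; exists z => //.
by exists (B z) => //; exists (gamma^-1 *: z).
Qed.

(** The inverses cancel: [B z] is the variable dual to [L x], and the parameter [gamma^-1] of the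
    inner composition puts [gamma Id] next to the inverse of [B]. *)
Lemma resolvent_cocompP gamma x y :
  resolvent_cocomp gamma L (setop_of B) x y <->
  exists2 z, y = adjoint L (B z) &
    z + gamma *: (B z - L (adjoint L (B z))) = L x.
Proof.
split=> [[p /parallel_compP[_ <- [z -> [_ -> zE]]] [_ -> <-]]|].
  by exists z => //; rewrite [RHS]linearB/= -zE invrK linearZ/= scalerBr addrA.
(* This is the value of the parallel composition at [y = L^* B z]; subtracting [gamma y] from it
   returns [x]. *)
move=> [z -> zE]; exists (x + gamma *: adjoint L (B z)).
  apply/parallel_compP; exists (B z) => //.
  exists z => //; exists (gamma *: B z); first by rewrite /setop_of/= invrK.
  by rewrite linearD linearZ/= -zE scalerBr addrA subrK.
by exists (gamma *: adjoint L (B z)); rewrite ?addrK// /setop_of/= invrK.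
Qed.

End ResolventCompositionsE.

(** * A criterion for operator-norm convergence by pointwise bounds *)

Lemma setop_cvg_bounded (R : realType) (H : hilbertType R) (F : set_system R)
    (FF : Filter F) (M_ : R -> setop H H) (M : setop H H) (e : R -> R)
    (K K0 : R) :
    F [set gamma | 0 < gamma] -> e gamma @[gamma --> F] --> (0 : R) ->
    (forall gamma, 0 < gamma -> 0 <= e gamma) -> 0 <= K ->
    setop_linear M -> (forall x, exists y, M x y) ->
    (forall x y, M x y -> `|y| <= K0 * `|x|) ->
    (forall gamma, setop_linear (M_ gamma)) ->
    (forall gamma x, 0 < gamma -> exists y, M_ gamma x y) ->
    (forall gamma x y y0, 0 < gamma -> M_ gamma x y -> M x y0 ->
      `|y - y0| <= K * e gamma * `|x|) ->
  setop_cvg F M_ M.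
Proof.
move=> F_gt0 e_cvg e_ge0 K_ge0 Mlin Mtot MK M_lin M_tot M_K.
have [T MT] := setop_linear_bounded Mlin Mtot MK.
have /choice[T_ M_T_] gamma :
    exists T_ : {bounded H -> H}, 0 < gamma -> M_ gamma = setop_of T_.
  (* Nothing is required of [T_] when [gamma <= 0]; the limit [T] serves as default value. *)
  have [g0|_] := ltP 0 gamma; last by exists T.
  have [||x y Mxy|T_ ->] := @setop_linear_bounded _ _ _ (M_ gamma)
      (K * e gamma + K0) => //; last by exists T_.
    by move=> x; exact: M_tot.
  (* The bound on [M_ gamma], and with it single-valuedness, follows from [|y| <= |y - y0| + |y0|]
     with [y0] the limit value. *)
  have [y0 My0] := Mtot x; rewrite -(subrK y0 y) mulrDl.
  by apply: le_trans (ler_normD _ _) _; rewrite lerD ?MK ?(M_K _ _ _ _ g0 Mxy).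
exists T_, T; split => //.
apply: (@squeeze_cvgr _ _ _ _ (fun=> 0) (fun gamma => K * e gamma)).
- apply: filterS F_gt0 => gamma g0 /=; rewrite opnorm_ge0/=.
  apply: opnorm_le => [|x]; first by rewrite mulr_ge0// e_ge0.
  by apply: M_K => //; [rewrite M_T_|rewrite MT].
- exact: cvg_cst.
- by rewrite -[X in _ --> X](mulr0 K); exact: cvgMl_tmp.
Qed.

Lemma strongly_positive_opP (R : realType) (H : hilbertType R)
    (A : {bounded H -> H}) : strongly_positive_op A ->
  (forall x y, '[A x, y] = '[x, A y]) /\
  exists2 c, 0 < c & forall x, c * `|x| ^+ 2 <= '[A x, x].
Proof.
move=> [[A_sa _] [c c0 [_ A_c]]]; split.
  by move=> x y; rewrite adjointE A_sa.
exists c => // x; have := A_c x.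
by rewrite /= innerBl innerZl -sqr_norm_inner subr_ge0.
Qed.

(** * Limit of the resolvent cocomposition as [gamma] tends to [0] *)

Section CocompositionLimit.
Variables (R : realType) (H G : hilbertType R).
Variables (L : {bounded H -> G}) (B : {bounded G -> G}) (c : R).
Hypothesis L_le1 : opnorm L <= 1.
Hypothesis B_sym : forall x y, '[B x, y] = '[x, B y].
Hypothesis c_gt0 : 0 < c.
Hypothesis B_coercive : forall x, c * `|x| ^+ 2 <= '[B x, x].

(* The form [<(Id - L L^* ) u, v>], nonnegative because [`|L| <= 1]. *)
Let Q (u v : G) := '[u, v] - '[adjoint L u, adjoint L v].

Let norm_adj u : `|adjoint L u| <= `|u|.
Proof. by apply: le_trans (norm_adjoint L u) _; rewrite ler_piMl. Qed.

Let norm_L x : `|L x| <= `|x|.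
Proof. by apply: le_trans (le_opnorm L x) _; rewrite ler_piMl. Qed.

Let Q_ge0 u : 0 <= Q u u.
Proof. by rewrite /Q -!sqr_norm_inner subr_ge0 lerXn2r ?nnegrE. Qed.

Let Q_linear v k u w : Q v (k *: u + w) = k * Q v u + Q v w.
Proof. by rewrite /Q innerPr linearP innerPr; ring. Qed.

Let Q_sym u v : Q u v = Q v u.
Proof. by rewrite /Q innerC (innerC (adjoint L u)). Qed.

Let Q_bounded u v : `|Q u v| <= 2 * `|u| * `|v|.
Proof.
apply: le_trans (ler_normB _ _) _; rewrite mulrDl mul1r mulrDl lerD//.
  exact: CauchySchwarz_inner.
by apply: le_trans (CauchySchwarz_inner _ _) _; rewrite ler_pM.
Qed.

Let Q_adjoint u v : '[u - L (adjoint L u), v] = Q u v.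
Proof. by rewrite innerBl adjointE. Qed.

(* Applying [B] to [z + gamma (Id - L L^* ) B z = L x] makes the equation
   symmetric and coercive in [z]. *)
Lemma cocomp_solvable gamma x : 0 < gamma ->
  exists z, z + gamma *: (B z - L (adjoint L (B z))) = L x.
Proof.
move=> g0.
pose a u v := '[B u, v] + gamma * Q (B u) (B v).
pose C := opnorm B + gamma * (2 * opnorm B * opnorm B).
have [||||||z az] := @coercive_representation R G a
    (fun v => '[B (L x), v]) c C `|B (L x)| _ _ c_gt0.
- by move=> z k u v; rewrite /a innerPr linearP Q_linear; ring.
- by move=> u v; rewrite /a B_sym innerC Q_sym.
- move=> u; apply: le_trans (B_coercive u) _.
  by rewrite lerDl mulr_ge0// ltW.
- move=> u v; apply: le_trans (ler_normD _ _) _.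
  rewrite /C 2!mulrDl lerD//.
    apply: le_trans (CauchySchwarz_inner _ _) _.
    by rewrite ler_wpM2r// le_opnorm.
  rewrite normrM gtr0_norm// -!mulrA ler_pM2l//.
  apply: le_trans (Q_bounded _ _) _.
  have -> : 2 * (opnorm B * (opnorm B * (`|u| * `|v|))) =
    2 * (opnorm B * `|u|) * (opnorm B * `|v|) by ring.
  by rewrite ler_pM ?mulr_ge0// ?le_opnorm// ler_pM2l ?le_opnorm.
- by move=> k u v; exact: innerPr.
- by move=> v; exact: CauchySchwarz_inner.
exists z; apply/eqP; rewrite -subr_eq0; set r := _ - L x; apply/eqP.
(* By symmetry of [B], the equation for [z] says that [B r] is orthogonal to every [v]; coercivity
   at [r] then gives [r = 0]. *)
have rB v : '[B r, v] = 0.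
  rewrite B_sym /r innerBl innerDl innerZl Q_adjoint -!B_sym.
  by rewrite -[X in X - _]/(a z v) az subrr.
have := B_coercive r; rewrite rB pmulr_rle0// => r0.
apply/eqP; rewrite -normr_eq0 -sqrf_eq0.
by rewrite eq_le r0 sqr_ge0.
Qed.

(** In the constant, [opnorm B ^+ 2 / c] comes from the estimate of [w = z - L x], and the third
    factor from applying [B] to [w]. *)
Lemma cocomp_near gamma x z : 0 < gamma ->
    z + gamma *: (B z - L (adjoint L (B z))) = L x ->
  `|adjoint L (B z) - adjoint L (B (L x))|
    <= 2 * opnorm B ^+ 3 / c * gamma * `|x|.
Proof.
move=> g0 zE; set K := opnorm B; set w := z - L x.
have K0 : 0 <= K by exact: opnorm_ge0.
have BLx : `|B (L x)| <= K * `|x|.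
  by apply: le_trans (le_opnorm B _) _; rewrite ler_wpM2l.
have w_le : `|w| <= 2 * gamma * K ^+ 2 * `|x| / c.
  apply: ler_coercive => //; first by rewrite !mulr_ge0 ?exprn_ge0// ltW.
  apply: le_trans (B_coercive w) _.
  have -> : '[B w, w] = - gamma * (Q (B w) (B w) + Q (B w) (B (L x))).
    have wE : w = - gamma *: (B z - L (adjoint L (B z))).
      by rewrite /w -zE opprD addrA subrr sub0r scaleNr.
    rewrite innerC {1}wE innerZl Q_adjoint.
    have -> : B z = 1 *: B w + B (L x) by rewrite scale1r linearB/= subrK.
    by rewrite Q_sym Q_linear mul1r.
  (* The term [- gamma Q (B w) (B w)] is nonpositive and is dropped; only the cross term, linear in
     [w], remains. *)
  apply: (@le_trans _ _ (gamma * `|Q (B w) (B (L x))|)).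
    rewrite mulNr -mulrN ler_pM2l//.
    have := Q_ge0 (B w); have := ler_norm (- Q (B w) (B (L x))).
    by rewrite normrN; lra.
  have -> : 2 * gamma * K ^+ 2 * `|x| * `|w| =
    gamma * (2 * (K * `|w|) * (K * `|x|)) by ring.
  rewrite ler_pM2l//; apply: le_trans (Q_bounded _ _) _.
  by rewrite ler_pM ?mulr_ge0// ler_pM2l// le_opnorm.
rewrite -linearB/= -linearB/=; apply: le_trans (norm_adj _) _.
apply: le_trans (le_opnorm B _) _; rewrite -/K -/w.
apply: le_trans (ler_wpM2l K0 w_le) _.
by rewrite le_eqVlt; apply/orP; left; apply/eqP; ring.
Qed.

Lemma resolvent_cocomp_cvg : setop_cvg (0 : R)^'+
  (fun gamma => resolvent_cocomp gamma L (setop_of B))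
  (setop_comp (setop_of (adjoint L)) (setop_comp (setop_of B) (setop_of L))).
Proof.
have limP x y : setop_comp (setop_of (adjoint L))
    (setop_comp (setop_of B) (setop_of L)) x y <-> y = adjoint L (B (L x)).
  split=> [[_ [_ -> ->] ->]//|->].
  by exists (B (L x)) => //; exists (L x).
apply: (@setop_cvg_bounded _ _ _ _ _ _ id (2 * opnorm B ^+ 3 / c) (opnorm B)).
- exact: nbhs_right_gt.
- exact: cvg_at_right_filter.
- by move=> gamma /ltW.
- by rewrite divr_ge0 ?(ltW c_gt0)// mulr_ge0// exprn_ge0// opnorm_ge0.
- apply: setop_linear_comp; last by apply: setop_linear_of; exact: linearP.
  by apply: setop_linear_comp; apply: setop_linear_of; exact: linearP.
- by move=> x; exists (adjoint L (B (L x))); apply/limP.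
- move=> x y /limP ->; apply: le_trans (norm_adj _) _.
  apply: le_trans (le_opnorm B _) _.
  by rewrite ler_wpM2l ?opnorm_ge0.
- move=> gamma; apply: setop_linear_resolvent_cocomp.
  by apply: setop_linear_of; exact: linearP.
- move=> gamma x /cocomp_solvable-/(_ x)[z zE].
  by exists (adjoint L (B z)); apply/resolvent_cocompP; exists z.
- move=> gamma x y y0 g0 /resolvent_cocompP[z -> zE] /limP ->.
  exact: cocomp_near.
Qed.

End CocompositionLimit.

(** * Limit of the resolvent composition as [gamma] tends to infinity *)

Section CompositionLimit.
Variables (R : realType) (H G : hilbertType R).
Variables (L : {bounded H -> G}) (B : {bounded G -> G}) (b c : R).
Hypothesis b_gt0 : 0 < b.
Hypothesis L_below : forall x, b * `|x| <= `|L x|.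
Hypothesis B_sym : forall x y, '[B x, y] = '[x, B y].
Hypothesis c_gt0 : 0 < c.
Hypothesis B_coercive : forall x, c * `|x| ^+ 2 <= '[B x, x].

Let norm_below x : `|x| <= b^-1 * `|L x|.
Proof. by rewrite mulrC ler_pdivlMr// mulrC. Qed.

(* [p] solves [L^* D^-1 L p = x] and [z = D^-1 L p], with [D = B + e Id]. *)
Lemma comp_solvable (e : R) x : 0 <= e ->
  exists z p, adjoint L z = x /\ B z + e *: z = L p.
Proof.
move=> e0.
(* [B + e Id], put as a difference so that it is again an element of [{bounded G -> G}]. *)
pose D : {bounded G -> G} := B \- (- e) \*: idfun.
have DE u : D u = B u + e *: u by rewrite /D /= scaleNr opprK.
have [|u|E [c' [c'0 DEK E_sym E_coercive]]] :=
  @coercive_inverse _ _ D c _ c_gt0.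
- by move=> u v; rewrite !DE innerDl innerDr innerZl innerZr B_sym.
- rewrite DE innerDl innerZl -sqr_norm_inner; apply: le_trans (B_coercive u) _.
  by rewrite lerDl mulr_ge0// sqr_ge0.
(* The form is coercive because [<E (L u), L u> >= c' |L u|^2 >= c' b^2 |u|^2]. *)
have [|||||||p pE] := @coercive_representation R H (fun y w => '[E (L y), L w])
    (fun w => '[x, w]) (c' * b ^+ 2) (opnorm E * opnorm L * opnorm L) `|x|.
- by move=> z k u v; rewrite linearP innerPr.
- by move=> u v; rewrite E_sym innerC.
- by rewrite mulr_gt0// exprn_gt0.
- move=> u; apply: le_trans (E_coercive _); rewrite -mulrA ler_pM2l// -exprMn.
  by rewrite lerXn2r ?nnegrE ?mulr_ge0// ltW.
- move=> u v; apply: le_trans (CauchySchwarz_inner _ _) _.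
  have -> : opnorm E * opnorm L * opnorm L * `|u| * `|v| =
    opnorm E * (opnorm L * `|u|) * (opnorm L * `|v|) by ring.
  apply: ler_pM => //; last exact: le_opnorm.
  apply: le_trans (le_opnorm E _) _.
  by rewrite ler_wpM2l ?opnorm_ge0// le_opnorm.
- by move=> k u v; exact: innerPr.
- by move=> v; exact: CauchySchwarz_inner.
exists (E (L p)), p; split; last by rewrite -DE DEK.
by apply: inner_inj => u; rewrite -adjointE innerC pE innerC.
Qed.

(** [c |z|^2 <= <B z, z> = <L p, z> = <p, x>], while [b |p| <= |L p| = |B z|] bounds [|p|] by a
    multiple of [|z|]; one factor [|z|] cancels. *)
Lemma norm_comp_dual x z p : adjoint L z = x -> B z = L p ->
  `|z| <= opnorm B / (b * c) * `|x|.
Proof.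
move=> zx zp.
have -> : opnorm B / (b * c) * `|x| = opnorm B / b * `|x| / c.
  by field; rewrite !gt_eqF.
apply: ler_coercive => //.
  by rewrite mulr_ge0// divr_ge0 ?opnorm_ge0// ltW.
apply: le_trans (B_coercive z) _; rewrite zp adjointE zx.
apply: le_trans (ler_norm _) (le_trans (CauchySchwarz_inner _ _) _).
rewrite [leRHS]mulrAC ler_wpM2r//; apply: le_trans (norm_below p) _.
by rewrite mulrC mulrAC ler_wpM2r ?invr_ge0 ?(ltW b_gt0)// -zp le_opnorm.
Qed.

Lemma norm_comp x z p : adjoint L z = x -> B z = L p ->
  `|p| <= b^-1 * (opnorm B * (opnorm B / (b * c))) * `|x|.
Proof.
move=> zx zp; apply: le_trans (norm_below p) _.
rewrite -mulrA ler_wpM2l ?invr_ge0 ?(ltW b_gt0)// -zp.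
apply: le_trans (le_opnorm B z) _; rewrite -mulrA ler_wpM2l ?opnorm_ge0//.
exact: norm_comp_dual zx zp.
Qed.

Lemma comp_near (e : R) x z p z0 p0 : 0 < e ->
    adjoint L z = x -> B z + e *: z = L p ->
    adjoint L z0 = x -> B z0 = L p0 ->
  `|p - e *: x - p0|
    <= (b^-1 * (opnorm B / c + 2) * (opnorm B / (b * c)) + 1) * e * `|x|.
Proof.
move=> e_gt0 zx zp z0x z0p; have e0 := ltW e_gt0.
set K := opnorm B; set K1 := K / (b * c).
have K0 : 0 <= K by exact: opnorm_ge0.
have z0_le : `|z0| <= K1 * `|x| by exact: norm_comp_dual z0x z0p.
pose d := z - z0.
have LpE : L (p - p0) = B d + e *: z.
  by rewrite !linearB/= -zp -z0p addrAC.
have dE : '[B d, d] + e * '[d, d] = - e * '[z0, d].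
  have : '[L (p - p0), d] = 0.
    by rewrite adjointE /d linearB/= zx z0x subrr linear0r.
  rewrite LpE innerDl innerZl -[in X in _ + _ * X](subrK z0 z) -/d innerDl.
  lra.
have d_e : e * `|d| ^+ 2 + c * `|d| ^+ 2 <= e * `|z0| * `|d|.
  have := B_coercive d; have := CauchySchwarz_inner z0 d.
  rewrite ler_norml => /andP[+ _] => /(ler_wpM2l e0).
  by move: dE; rewrite -sqr_norm_inner; lra.
(* Discarding [e |d|^2] in [d_e] shows that [d] is of order [e]. *)
have d_le : `|d| <= e * `|z0| / c.
  apply: ler_coercive; rewrite ?mulr_ge0//.
  by apply: le_trans d_e; rewrite lerDr mulr_ge0// sqr_ge0.
(* Discarding [c |d|^2] instead gives a bound uniform in [e], hence [|z| <= 2 |z0|], which controls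
   the term [e z] of [L (p - p0)]. *)
have d_le' : `|d| <= `|z0|.
  rewrite -[leRHS](@mulfK _ e) ?gt_eqF// [`|z0| * e]mulrC.
  apply: ler_coercive; rewrite ?mulr_ge0//.
  by apply: le_trans d_e; rewrite lerDl mulr_ge0 ?(ltW c_gt0)// sqr_ge0.
have p_le : `|p - p0| <= b^-1 * ((K / c + 2) * e * `|z0|).
  apply: le_trans (norm_below _) _; rewrite ler_wpM2l ?invr_ge0 ?(ltW b_gt0)//.
  rewrite LpE; apply: le_trans (ler_normD _ _) _.
  have Bd : `|B d| <= K * (e * `|z0| / c).
    by apply: le_trans (le_opnorm B d) _; rewrite ler_wpM2l.
  have ez : `|e *: z| <= e * (2 * `|z0|).
    rewrite normrZ gtr0_norm// ler_pM2l// -(subrK z0 z) -/d.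
    by apply: le_trans (ler_normD _ _) _; rewrite mulrDl !mul1r lerD2r.
  apply: le_trans (lerD Bd ez) _.
  by rewrite le_eqVlt; apply/orP; left; apply/eqP; ring.
(* The summand [1] of the constant accounts for the shift [e x] between [p] and the resolvent
   composition. *)
have -> : (b^-1 * (K / c + 2) * K1 + 1) * e * `|x| =
  b^-1 * ((K / c + 2) * e * (K1 * `|x|)) + e * `|x| by ring.
rewrite addrAC; apply: le_trans (ler_normB _ _) _.
rewrite normrZ gtr0_norm// lerD2r; apply: le_trans p_le _.
rewrite ler_wpM2l ?invr_ge0 ?(ltW b_gt0)// ler_wpM2l//.
by rewrite mulr_ge0// addr_ge0// divr_ge0// ltW.
Qed.

Lemma resolvent_comp_cvg : setop_cvg (+oo : set_system R)
  (fun gamma => resolvent_comp gamma L (setop_of B))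
  (parallel_comp L (setop_of B)).
Proof.
set K := b^-1 * (opnorm B / c + 2) * (opnorm B / (b * c)) + 1.
have inv_ge0 := (ltW b_gt0, ltW c_gt0, opnorm_ge0 B).
apply: (@setop_cvg_bounded _ _ _ _ _ _ (fun gamma => gamma^-1) K
  (b^-1 * (opnorm B * (opnorm B / (b * c))))).
- exact: nbhs_pinfty_gt.
- by apply/(@gtr0_cvgV0 _ _ _ _ id); [exact: nbhs_pinfty_gt|exact: cvg_id].
- by move=> gamma /ltW; rewrite invr_ge0.
- by rewrite /K !(addr_ge0, mulr_ge0, invr_ge0) ?inv_ge0.
- by apply: setop_linear_parallel_comp; apply: setop_linear_of; exact: linearP.
(* The limit relation is the case [e = 0] of the same system. *)
- move=> x; have [z [p [zx zp]]] := comp_solvable x (lexx 0).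
  exists p; apply/parallel_compP; exists z => //.
  by rewrite /setop_of/= -zp scale0r addr0.
- by move=> x y /parallel_compP[z zx zy]; exact: norm_comp zx (esym zy).
- move=> gamma; apply: setop_linear_resolvent_comp.
  by apply: setop_linear_of; exact: linearP.
- move=> gamma x g0; have gV : 0 <= gamma^-1 by rewrite invr_ge0 ltW.
  have [z [p [zx zp]]] := comp_solvable x gV.
  by exists (p - gamma^-1 *: x); apply/resolvent_compP; exists z, p.
- move=> gamma x y y0 g0 /resolvent_compP[z [p [zx zp ->]]].
  move=> /parallel_compP[z0 z0x z0y].
  by apply: comp_near zx zp z0x (esym z0y); rewrite invr_gt0.
Qed.

End CompositionLimit.

(** * Both limits for a strongly positive operator *)

Theorem theorem3p6 (R : realType) (H G : hilbertType R)
    (L : {bounded H -> G}) (B : {bounded G -> G}) :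
  0 < opnorm L <= 1 ->
  strongly_positive_op B ->
  setop_cvg (0 : R)^'+
    (fun gamma => resolvent_cocomp gamma L (setop_of B))
    (setop_comp (setop_of (adjoint L))
                (setop_comp (setop_of B) (setop_of L)))
  /\
  (bounded_below L ->
   setop_cvg (+oo : set_system R)
     (fun gamma => resolvent_comp gamma L (setop_of B))
     (parallel_comp L (setop_of B))).
Proof.
move=> /andP[_ L_le1] /strongly_positive_opP[B_sym [c c_gt0 B_coercive]].
split; first exact: resolvent_cocomp_cvg c_gt0 B_coercive.
move=> [b b_gt0 L_below].
exact: resolvent_comp_cvg b_gt0 L_below B_sym c_gt0 B_coercive.
Qed.
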